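(* Let $F\in L^2_{\mathbb{X}}$ have the infinite Hoeffding decomposition $F=\sum_{M\in\mathcal{P}_{fin}(\mathbb{N})}F_M$. Then, for any $k\in\mathbb{N}$, the infinite Hoeffding decomposition of $D_kF$ is given by $$D_kF=\sum_{M\in\mathcal{P}_{fin}(\mathbb{N}):\,k\in M}F_M.$$
   Context: Let $\mathbb{X}=(X_n)_{n\in\mathbb{N}}$ be a sequence of independent random variables on a probability space $(\Omega,\mathcal{A},\mathbb{P})$, $X_n$ taking values in an arbitrary measurable space $(E_n,\mathcal{B}_n)$. Let $\mathcal{F}=\sigma(\mathbb{X})$, $\mathcal{F}_M=\sigma(X_j: j\in M)$ for $M\subseteq\mathbb{N}$, $\mathcal{G}_k=\sigma(X_j:j\ne k)$, and $L^2_{\mathbb{X}}=L^2(\Omega,\mathcal{F},\mathbb{P})$. For $F\in L^2_{\mathbb X}$ and $k\in\mathbb{N}$ put $D_kF:=F-\mathbb{E}[F\mid\mathcal{G}_k]$. $\mathcal{P}_{fin}(\mathbb{N})$ is the set of finite subsets of $\mathbb{N}$. For $F\in L^2_{\mathbb{X}}$ and $M\in\mathcal{P}_{fin}(\mathbb{N})$ let $F_M:=\sum_{L\subseteq M}(-1)^{|M|-|L|}\mathbb{E}[F\mid\mathcal{F}_L]$ (the Hoeffding components). Each $F_M$ is $\mathcal{F}_M$-measurable, $\mathbb{E}[F_M\mid\mathcal{F}_K]=0$ a.s. unless $M\subseteq K$, the $F_M$ are pairwise orthogonal, and $F=\sum_{M\in\mathcal{P}_{fin}(\mathbb{N})}F_M$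 with unconditional convergence in $L^2(\mathbb{P})$; this a.s. unique representation is the infinite Hoeffding decomposition of $F$. *)

(* Defs.v *)
From HB Require Import structures.
From mathcomp Require Import all_boot all_order all_algebra finmap.
From mathcomp Require Import all_classical all_reals all_analysis.
From mathcomp Require summability.

Set Implicit Arguments.
Unset Strict Implicit.
Unset Printing Implicit Defensive.

Import Order.TTheory GRing.Theory Num.Theory.
Import numFieldNormedType.Exports.

Local Open Scope classical_set_scope.
Local Open Scope ring_scope.

Section conditional_expectation.
Context {d : measure_display} {T : measurableType d} {R : realType}.
Variable P : probability T R.
Implicit Types (G : set (set T)) (F Y : T -> R).

(* A sub-sigma-algebra is represented by the set G of its events;
   [g_sigma_algebra_preimage Y `<=` G] says that sigma(Y) is contained in G,
   i.e. that Y is G-measurable. *)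
Definition is_condexp G F Y : Prop :=
  [/\ g_sigma_algebra_preimage Y `<=` G,
      P.-integrable [set: T] (EFin \o Y)
    & forall A, G A -> \int[P]_(x in A) (Y x)%:E = \int[P]_(x in A) (F x)%:E]%E.

(* A chosen version of E[F | G].  Versions exist as soon as F is integrable
   (the value [cst 0] is used otherwise) and are a.s. equal. *)
Definition condexp G F : T -> R := xget (cst 0) [set Y | is_condexp G F Y].

End conditional_expectation.

Section hoeffding.
Context {d : measure_display} {T : measurableType d} {R : realType}.
Variable P : probability T R.
Context {dE : nat -> measure_display} {E : forall n, measurableType (dE n)}.
Variable X : forall n, {RV P >-> E n}.
Implicit Types (F : T -> R) (f : {fset nat} -> T -> R).

Definition mutually_independent : Prop :=
  forall (J : {fset nat}) (B : forall n, set (E n)),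
    (forall n, n \in J -> measurable (B n)) ->
    P (\bigcap_(n in [set` J]) X n @^-1` B n) =
      (\prod_(n <- J) P (X n @^-1` B n))%E.

(* F_M = sigma(X_j : j in M) *)
Definition sigmaX (M : set nat) : set (set T) :=
  <<s \bigcup_(j in M) g_sigma_algebra_preimage (X j) >>.

Definition L2X : set (T -> R) :=
  [set F | F \in Lfun P 2%:E /\ g_sigma_algebra_preimage F `<=` sigmaX setT].

Definition D (k : nat) F : T -> R :=
  fun t => F t - condexp P (sigmaX [set j | j <> k]) F t.

Definition hoeffding_component F (M : {fset nat}) : T -> R :=
  fun t => \sum_(L <- fpowerset M)
    (-1) ^+ (#|` M| - #|` L|) * condexp P (sigmaX [set` L]) F t.

(* F is the sum of the f M with M in S, unconditionally in L^2(P): the net of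
   all finite partial sums, directed by inclusion, converges to F. *)
Definition L2_unconditional_sum (S : {pred {fset nat}}) f F : Prop :=
  (fun J : {fset {fset nat}} =>
     'N[P]_2%:E[(fun t => (F t - \sum_(M <- J | M \in S) f M t)%:E)]%E)
    @ summability.totally --> 0%E.

Record hoeffding_decomposition F f : Prop := {
  hoeffding_componentE :
    forall M, f M = hoeffding_component F M %[ae P] ;
  hoeffding_L2 : forall M, f M \in Lfun P 2%:E ;
  hoeffding_measurable :
    forall M, g_sigma_algebra_preimage (f M) `<=` sigmaX [set` M] ;
  hoeffding_condexp0 : forall (M : {fset nat}) (K : set nat),
    ~ [set` M] `<=` K -> condexp P (sigmaX K) (f M) = cst 0 %[ae P] ;
  hoeffding_orthogonal :
    forall M N, M != N -> ('E_P[(fun t => f M t * f N t)%R] = 0)%E ;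
  hoeffding_sum : L2_unconditional_sum predT f F
}.

End hoeffding.

Arguments mutually_independent {d T R} P {dE E} X.
Arguments L2X {d T R} P {dE E} X.
Arguments D {d T R} P {dE E} X k F.
Arguments hoeffding_component {d T R} P {dE E} X F M.
Arguments L2_unconditional_sum {d T R} P S f F.
Arguments hoeffding_decomposition {d T R} P {dE E} X F f.

(* Main.v *)
Require Import Defs.
From HB Require Import structures.
From mathcomp Require Import all_boot all_order all_algebra finmap.
From mathcomp Require Import all_classical all_reals all_analysis.
From mathcomp Require Import measurable_realfun.
From mathcomp Require Import ring lra.
From mathcomp Require summability.

(** The operator E[. | G_k] removes the coordinate k: by independence,
    E[E[F | G_k] | F_L] = E[F | F_(L minus k)].  Hence E[D_k F | F_L] is
    E[F | F_L] - E[F | F_(L minus k)], and the component of D_k F at M is the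
    component of F at M minus the alternating sum over L <= M of the
    E[F | F_(L minus k)].  If k is in M this alternating sum is 0, since adding k
    to L or removing it changes the sign but not the term; if k is not in M it is
    the component of F itself.  So the components of D_k F are those of F
    with k in M, and 0 otherwise ([component_D]).  It remains to know that every
    function in L^2_X is the unconditional sum of its components, and to apply
    this to D_k F.

    The measure theory rests on a functional monotone class theorem
    ([functional_monotone_class]) and on its corollary [integral_mul_eq0]: if h
    integrates to 0 over a generating pi-system, it is orthogonal to all
    functions measurable for the generated sigma-algebra.  Conditional
    expectations exist by Radon-Nikodym ([condexp_exists]), are unique almost
    everywhere, and preserve L^2 ([condexp_Lfun2]).  Independence is used through
    one identity, E[E[F | F_L] | F_K] = E[F | F_(K & L)] ([condexpX_condexpX]),
    obtained by checking it on cylinders.  It turns E[F_M | F_K], for M not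
    included in K, into an alternating sum that a sign-reversing involution
    ([sum_toggle_eq0]) shows to be 0, and this implies orthogonality.  The same
    involutions give Moebius inversion, E[F | F_K] = \sum_(M <= K) F_M for finite
    K.

    For the convergence, functions of finitely many coordinates are dense
    ([finite_approx]), so F is within e of some E[F | F_K] with K finite.  If J
    contains all subsets of K, then by orthogonality the partial sum over J is at
    least as close to F as E[F | F_K] is ([partial_sum_le]). *)

Set Implicit Arguments.
Unset Strict Implicit.
Unset Printing Implicit Defensive.

Import Order.TTheory GRing.Theory Num.Theory.
Import numFieldNormedType.Exports.

Local Open Scope classical_set_scope.
Local Open Scope ring_scope.

(** * Functional monotone class theorem *)

Section monotone_class.
Import HBSimple HBNNSimple.
Context {T : pointedType} {R : realType}.
Implicit Types (C : set (set T)) (f g : T -> R).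

(** Turns the inclusion sigma(f) <= <<s C >>, which is how sub-sigma-algebra
    measurability is expressed here, into measurability for the type
    [g_sigma_algebraType C], so that the closure lemmas on measurable functions
    become applicable. *)
Lemma preimage_measurableP C f :
  g_sigma_algebra_preimage f `<=` <<s C >> <->
  measurable_fun setT (f : g_sigma_algebraType C -> R).
Proof.
split=> [fC _ B mB|mf _ [B mB <-]]; first by apply: fC; exists B.
exact: mf.
Qed.

(** The collection of sets whose indicator is in V is a lambda-system, hence
    contains <<s C >> by the pi-lambda theorem.  By linearity V contains the
    simple functions, and f is the difference of two increasing pointwise limits
    of simple functions, all dominated by |f| <= b.  The envelope b is fixed in
    advance so that unbounded f can be reached while limits stay dominated; it
    is at least 1 so that it also dominates indicators. *)
Lemma functional_monotone_class C (V : set (T -> R)) (b : T -> R) :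
  setI_closed C -> C setT -> (forall x, 1 <= b x) ->
  (forall A, C A -> V \1_A) ->
  (forall a f g, V f -> V g -> V (fun x => a * f x + g x)) ->
  (forall (g_ : nat -> T -> R) g, (forall n, V (g_ n)) ->
     (forall n x, `|g_ n x| <= b x) -> (forall x, g_ ^~ x @ \oo --> g x) ->
     V g) ->
  forall f, g_sigma_algebra_preimage f `<=` <<s C >> ->
    (forall x, `|f x| <= b x) -> V f.
Proof.
move=> CI CT b1 VC VD Vlim.
have V0 : V (fun=> 0).
  have /(VD (-1) _ _ (VC _ CT)) := VC _ CT.
  by congr V; apply/funext => x; rewrite mulN1r addNr.
have Vind A : <<s C >> A -> V \1_A.
  move: A; apply: lambda_system_subset => //.
  split=> //.
  - exact: VC.
  - move=> A B BA VA VB; have := VD (-1) _ _ VB VA.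
    congr V; apply/funext => x; rewrite !indicE in_setD mulN1r.
    have [xB|xB] := boolP (x \in B); last by rewrite oppr0 add0r andbT.
    by rewrite (mem_set (BA _ (set_mem xB))) addNr.
  - move=> A_ ndA VA; apply: (Vlim (fun n => \1_(A_ n))) => //.
      move=> n x; rewrite indicE (le_trans _ (b1 x))//.
      by rewrite ger0_norm ?ler0n// lern1 leq_b1.
    move=> x; have [[n _ Anx]|nA] := pselect ((\bigcup_n A_ n) x).
      apply: cvg_near_cst; exists n => // m /= nm; rewrite !indicE !mem_set//.
        by exists n.
      by have /subsetPset := ndA _ _ nm; exact.
    rewrite [X in _ --> X]indicE memNset//; apply: cvg_near_cst.
    by near=> n; rewrite indicE memNset// => Anx; apply: nA; exists n.
have Vpos (f : T -> R) : g_sigma_algebra_preimage f `<=` <<s C >> ->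
    (forall x, 0 <= f x) -> (forall x, `|f x| <= b x) -> V f.
  move=> /preimage_measurableP mf f0 fb.
  pose f' : g_sigma_algebraType C -> R := f.
  have mef : measurable_fun setT (EFin \o f').
    exact/measurable_EFinP.
  have ef0 x : [set: T] x -> (0 <= (EFin \o f') x)%E by rewrite lee_fin f0.
  pose g_ := nnsfun_approx measurableT mef.
  apply: (Vlim (fun n => g_ n : T -> R)).
  - move=> n.
    have -> : (g_ n : T -> R) = fun x => \sum_(y <- fset_set (range (g_ n)))
        y * \1_(g_ n @^-1` [set y]) x.
      by apply/funext => x; rewrite [LHS]fimfunE fsbig_finite.
    elim: (finmap.enum_fset _) => [|y s IH].
      by under eq_fun do rewrite big_nil.
    under eq_fun do rewrite big_cons; apply: VD => //; apply: Vind.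
    have : measurable (g_ n @^-1` [set y]) by apply: measurable_funPTI.
    exact.
  - move=> n x; rewrite ger0_norm//; apply: le_trans (fb x).
    rewrite ger0_norm// -lee_fin /g_ nnsfun_approxE.
    exact: (@le_approx _ (g_sigma_algebraType C) _ _ (EFin \o f') n x ef0 I).
  - move=> x.
    have := @cvg_nnsfun_approx _ (g_sigma_algebraType C) _ _ measurableT _ mef ef0 x I.
    by move=> gx; apply: (fine_cvg gx).
move=> f /preimage_measurableP mf fb.
have -> : f = fun x => -1 * f^\- x + f^\+ x.
  by apply/funext => x; rewrite mulN1r addrC -[LHS]/(f x) -{1}(funrposBneg f).
have fpn x : `|f x| = f^\+ x + f^\- x by rewrite -/((Num.norm \o f) x) -funrposDneg.
apply: VD; apply: Vpos.
- by apply/preimage_measurableP; exact: measurable_funrneg.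
- by [].
- by move=> x; rewrite ger0_norm// (le_trans _ (fb x))// fpn lerDr.
- by apply/preimage_measurableP; exact: measurable_funrpos.
- by [].
- by move=> x; rewrite ger0_norm// (le_trans _ (fb x))// fpn lerDl.
Unshelve. all: by end_near. Qed.

End monotone_class.

(** * Integrals of real functions and orthogonality *)

Section real_integrals.
Context d (T : measurableType d) (R : realType).
Variable mu : {measure set T -> \bar R}.
Implicit Types (f g h : T -> R) (A : set T) (C : set (set T)).

Lemma integrable_measurable f :
  mu.-integrable setT (EFin \o f) -> measurable_fun setT f.
Proof. by case/integrableP => /measurable_EFinP. Qed.

Lemma integrable_le f g : measurable_fun setT f ->
  mu.-integrable setT (EFin \o g) -> (forall x, `|f x| <= `|g x|) ->
  mu.-integrable setT (EFin \o f).
Proof.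
move=> mf ig fg; apply: le_integrable ig => //; first exact/measurable_EFinP.
by move=> x _; rewrite /= lee_fin.
Qed.

Lemma integrable_lin a f g : mu.-integrable setT (EFin \o f) ->
  mu.-integrable setT (EFin \o g) ->
  mu.-integrable setT (EFin \o (fun x => a * f x + g x)).
Proof.
move=> fi gi.
rewrite (_ : _ \o _ = (fun x => a%:E * (f x)%:E + (g x)%:E)%E).
  by apply: integrableD => //; exact: integrableZl.
by apply/funext => x /=; rewrite EFinD EFinM.
Qed.

Lemma Rintegral_lin a f g : mu.-integrable setT (EFin \o f) ->
  mu.-integrable setT (EFin \o g) ->
  \int[mu]_x (a * f x + g x) = a * \int[mu]_x f x + \int[mu]_x g x.
Proof.
move=> fi gi; rewrite RintegralD//; first by rewrite RintegralZl.
by have := integrableZl measurableT a fi; apply: eq_integrable.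
Qed.

Lemma integrable_indicM A f : measurable A ->
  mu.-integrable setT (EFin \o f) ->
  mu.-integrable setT (EFin \o (fun x => \1_A x * f x)).
Proof.
move=> mA fi; apply: (@integrable_le _ f) => //.
  by apply: measurable_funM => //; exact: integrable_measurable.
move=> x; rewrite normrM indicE; case: (x \in A); first by rewrite normr1 mul1r.
by rewrite normr0 mul0r.
Qed.

Lemma integral_setE A f : measurable A -> mu.-integrable setT (EFin \o f) ->
  (\int[mu]_(x in A) (f x)%:E = (\int[mu]_x (\1_A x * f x))%:E)%E.
Proof.
move=> mA fi; rewrite /Rintegral fineK; last first.
  exact: (integrable_fin_num measurableT (integrable_indicM mA fi)).
rewrite integral_mkcond; apply: eq_integral => x _.
by rewrite /patch indicE; case: ifP => _; rewrite ?mul1r ?mul0r.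
Qed.

Lemma dominated_Rintegral (f_ : nat -> T -> R) f g :
  (forall n, measurable_fun setT (f_ n)) ->
  mu.-integrable setT (EFin \o g) -> (forall n x, `|f_ n x| <= g x) ->
  (forall x, f_ ^~ x @ \oo --> f x) ->
  [/\ measurable_fun setT f, mu.-integrable setT (EFin \o f) &
      (\int[mu]_x f_ n x) @[n --> \oo] --> \int[mu]_x f x].
Proof.
move=> mf_ ig fg ff.
have mf : measurable_fun setT f.
  by apply: (measurable_fun_cvg mf_) => x _; exact: ff.
have [|||||fi _ cv] := @dominated_convergence _ _ _ mu _ measurableT
  (fun n => EFin \o f_ n) (EFin \o f) (EFin \o g).
- by move=> n; exact/measurable_EFinP.
- exact/measurable_EFinP.
- by apply/aeW => x _; apply: cvg_EFin; [exact: nearW|exact: ff].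
- by [].
- by apply/aeW => x n _; rewrite /= lee_fin.
split=> //; apply: fine_cvg; rewrite /Rintegral fineK//.
exact: (integrable_fin_num measurableT fi).
Qed.

Lemma sub_g_sigma_measurable C : C `<=` measurable -> <<s C >> `<=` measurable.
Proof. by move=> CM; apply: smallest_sub => //; exact: sigma_algebra_measurable. Qed.

(** Orthogonality to the indicators of a generating pi-system extends to every
    <<s C >>-measurable f, bounded or not, as soon as f h is integrable:
    functional monotone class with envelope 1 + |f|, the dominating function of
    the products being (1 + |f|) |h|.  Uniqueness and self-adjointness of
    conditional expectations as well as the use of independence are all
    instances of this lemma. *)
Lemma integral_mul_eq0 C h f : setI_closed C -> C setT -> C `<=` measurable ->
  mu.-integrable setT (EFin \o h) ->
  (forall A, C A -> \int[mu]_x (\1_A x * h x) = 0) ->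
  g_sigma_algebra_preimage f `<=` <<s C >> ->
  mu.-integrable setT (EFin \o (fun x => f x * h x)) ->
  \int[mu]_x (f x * h x) = 0.
Proof.
move=> CI CT CM hi h0 fC fhi.
have mh := integrable_measurable hi.
pose V := [set g : T -> R | [/\ measurable_fun setT g,
  mu.-integrable setT (EFin \o (fun x => g x * h x)) &
  \int[mu]_x (g x * h x) = 0]].
suff [] : V f by [].
apply: (@functional_monotone_class _ _ C V (fun x => 1 + `|f x|)) => //.
- by move=> x; rewrite lerDl.
- move=> A CA; have mA := CM _ CA.
  by split; [exact: measurable_indic|exact: integrable_indicM|exact: h0].
- move=> a g k [mg gi g0] [mk ki k0].
  have E : (fun x => (a * g x + k x) * h x) = fun x => a * (g x * h x) + k x * h x.
    by apply/funext => x; rewrite mulrDl mulrA.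
  split; rewrite ?E.
  + by apply: measurable_funD => //; apply: measurable_funM.
  + exact: integrable_lin.
  + by rewrite Rintegral_lin// g0 k0 mulr0 addr0.
- move=> g_ g Vg gb gg.
  have mg n : measurable_fun setT (g_ n) by case: (Vg n).
  have [|||| mgh gi cv] := @dominated_Rintegral (fun n x => g_ n x * h x)
    (fun x => g x * h x) (fun x => 1 * `|h x| + `|f x * h x|).
  + by move=> n; exact: measurable_funM.
  + by apply: integrable_lin; exact: integrable_norm.
  + by move=> n x; rewrite !normrM -mulrDl; exact: ler_wpM2r.
  + by move=> x; apply: cvgM; [exact: gg|exact: cvg_cst].
  split=> //; first by apply: (measurable_fun_cvg mg) => x _; exact: gg.
  rewrite -(cvg_lim _ cv)//; apply: cvg_lim => //; apply: cvg_near_cst.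
  by apply: nearW => n; case: (Vg n).
- by move=> x; rewrite lerDr.
Qed.

End real_integrals.

(** * Conditional expectations: existence and uniqueness *)

Section conditional_expectation_theory.
Context d (T : measurableType d) (R : realType).
Variable P : probability T R.
Implicit Types (f g h : T -> R) (A : set T) (C : set (set T)).

Lemma preimage_indic C A : <<s C >> A ->
  g_sigma_algebra_preimage (\1_A : T -> R) `<=` <<s C >>.
Proof.
move=> CA; apply/preimage_measurableP.
exact: (@measurable_indic _ (g_sigma_algebraType C)).
Qed.

Lemma preimage_lin C a f g : g_sigma_algebra_preimage f `<=` <<s C >> ->
  g_sigma_algebra_preimage g `<=` <<s C >> ->
  g_sigma_algebra_preimage (fun x => a * f x + g x) `<=` <<s C >>.
Proof.
move=> /preimage_measurableP mf /preimage_measurableP mg.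
by apply/preimage_measurableP; apply: measurable_funD => //; exact: measurable_funM.
Qed.

Lemma preimage_mul C f g : g_sigma_algebra_preimage f `<=` <<s C >> ->
  g_sigma_algebra_preimage g `<=` <<s C >> ->
  g_sigma_algebra_preimage (fun x => f x * g x) `<=` <<s C >>.
Proof.
move=> /preimage_measurableP mf /preimage_measurableP mg.
by apply/preimage_measurableP; exact: measurable_funM.
Qed.

Lemma preimage_cst C (a : R) : g_sigma_algebra_preimage (cst a : T -> R) `<=` <<s C >>.
Proof. by apply/preimage_measurableP; exact: measurable_cst. Qed.

Lemma integrable_cst (a : R) : P.-integrable setT (EFin \o cst a).
Proof. exact: finite_measure_integrable_cst. Qed.

(** Radon-Nikodym on the coarser measurable space <<s C >>: both P and the charge
    with density f are pushed forward along the identity map from T to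
    [g_sigma_algebraType C], which is measurable since C is included in the
    sigma-algebra of T. *)
Lemma condexp_exists C f : C `<=` measurable ->
  P.-integrable setT (EFin \o f) -> exists g, is_condexp P <<s C >> f g.
Proof.
move=> CM fi; pose TC := g_sigma_algebraType C.
pose phi : T -> TC := idfun.
have mphi : measurable_fun setT phi.
  by move=> _ B mB; rewrite setTI; exact: (sub_g_sigma_measurable CM).
pose mphi_mixin := isMeasurableFun.Build _ _ _ _ phi mphi.
pose phi_pack : {mfun T >-> TC} := MeasurableFun.Pack (MeasurableFun.Class mphi_mixin).
pose PC := distribution P phi_pack.
pose nu_ : {charge set TC -> \bar R} := pushforward (induced_charge fi) phi_pack.
pose nu := nu_ mphi.
have nuPC : nu `<< PC.
  apply/null_content_dominatesP => A CA PA0; apply: null_set_integral => //.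
    exact: sub_g_sigma_measurable CA.
  by apply/measurable_funTS/measurable_EFinP; exact: integrable_measurable fi.
pose g0 := Radon_Nikodym nu PC.
have g0i : PC.-integrable setT g0 := Radon_Nikodym_integrable nuPC.
pose g : T -> R := fine \o g0.
have gE : EFin \o g = g0 :> (T -> \bar R).
  by apply/funext => x; rewrite /= fineK// Radon_Nikodym_fin_num.
have mg0 := measurable_int _ g0i.
have mg0' : measurable_fun setT (g0 : T -> \bar R).
  exact: (measurableT_comp mg0 mphi).
have gi : P.-integrable setT (EFin \o g).
  rewrite gE; apply/integrableP; split => //.
  case/integrableP : g0i => _.
  rewrite ge0_integral_pushforward//; exact: measurableT_comp.
exists g; split => //.
- apply/preimage_measurableP; apply: measurableT_comp mg0.
  exact: fine_measurable.
- move=> A CA; rewrite -[RHS]/(nu A) (Radon_Nikodym_integral nuPC)//.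
  rewrite -/g0 (integral_pushforward mphi)//; last first.
    by apply: (integrableS measurableT); rewrite -?gE//; exact: sub_g_sigma_measurable CA.
  by apply: eq_integral => x _; rewrite -gE.
Qed.

(** The difference h integrates to 0 over {h > 0} and over {h < 0}, which both
    belong to <<s C >>, so the integral of |h| is 0. *)
Lemma ae_eq_sub_sigma C f g : setI_closed C -> C setT -> C `<=` measurable ->
  P.-integrable setT (EFin \o f) -> P.-integrable setT (EFin \o g) ->
  g_sigma_algebra_preimage f `<=` <<s C >> ->
  g_sigma_algebra_preimage g `<=` <<s C >> ->
  (forall A, C A -> \int[P]_x (\1_A x * f x) = \int[P]_x (\1_A x * g x)) ->
  f = g %[ae P].
Proof.
move=> CI CT CM fi gi fC gC fg.
pose h x := -1 * g x + f x.
have hi : P.-integrable setT (EFin \o h) by exact: integrable_lin.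
have hC : g_sigma_algebra_preimage h `<=` <<s C >> by exact: preimage_lin.
have mh := integrable_measurable hi.
have h0 A : C A -> \int[P]_x (\1_A x * h x) = 0.
  move=> CA; have mA := CM _ CA.
  rewrite (_ : (fun x => _) = fun x => -1 * (\1_A x * g x) + \1_A x * f x).
    by rewrite Rintegral_lin ?fg ?mulN1r ?addNr//; exact: integrable_indicM.
  by apply/funext => x; rewrite mulrDr mulrCA.
have h1 A : <<s C >> A -> \int[P]_x (\1_A x * h x) = 0.
  move=> CA; apply: (integral_mul_eq0 CI) => //; first exact: preimage_indic.
  by apply: integrable_indicM => //; exact: sub_g_sigma_measurable CA.
have Cp : <<s C >> (h @^-1` `]0, +oo[%classic).
  by apply: hC; exists (`]0, +oo[%classic); rewrite ?setTI.
have Cn : <<s C >> (h @^-1` `]-oo, 0[%classic).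
  by apply: hC; exists (`]-oo, 0[%classic); rewrite ?setTI.
have habs : \int[P]_x `|h x| = 0.
  rewrite (_ : (fun x => _) = fun x => -1 * (\1_(h @^-1` `]-oo, 0[%classic) x * h x) +
     \1_(h @^-1` `]0, +oo[%classic) x * h x).
    rewrite Rintegral_lin ?h1 ?mulr0 ?addr0//; apply: integrable_indicM => //;
      exact: (sub_g_sigma_measurable CM).
  apply/funext => x; rewrite !indicE.
  have -> : (x \in h @^-1` `]-oo, 0[%classic) = (h x < 0).
    by apply/idP/idP; rewrite inE/= in_itv.
  have -> : (x \in h @^-1` `]0, +oo[%classic) = (0 < h x).
    by apply/idP/idP; rewrite inE/= in_itv/= andbT.
  have [h0'|h0'|->] := ltgtP (h x) 0.
  - by rewrite ltr0_norm// mul1r mul0r addr0 mulN1r.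
  - by rewrite gtr0_norm// mul1r mul0r mulr0 add0r.
  - by rewrite normr0 mul0r mulr0 addr0.
have := congr1 EFin habs; rewrite /Rintegral fineK; last first.
  by apply: integrable_fin_num => //; exact: integrable_norm.
have mEh : measurable_fun setT (EFin \o h) by exact/measurable_EFinP.
move=> /(ae_eq_integral_abs P measurableT mEh).
apply: filterS => x /(_ I) /= [] /eqP; rewrite /h mulN1r addrC subr_eq0.
by move=> /eqP.
Qed.

Lemma condexpP C f : C `<=` measurable -> P.-integrable setT (EFin \o f) ->
  is_condexp P <<s C >> f (condexp P <<s C >> f).
Proof.
move=> CM /(condexp_exists CM) fg.
exact: (@xgetPex _ (cst 0) [set Y | is_condexp P <<s C >> f Y] fg).
Qed.

(** Real-valued form of the defining property, stated with products by
    indicators so that linearity of the integral applies directly. *)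
Lemma is_condexpP C f g : C `<=` measurable -> P.-integrable setT (EFin \o f) ->
  is_condexp P <<s C >> f g <->
  [/\ g_sigma_algebra_preimage g `<=` <<s C >>, P.-integrable setT (EFin \o g) &
  forall A, <<s C >> A -> \int[P]_x (\1_A x * g x) = \int[P]_x (\1_A x * f x)].
Proof.
move=> CM fi; have mC A := @sub_g_sigma_measurable _ _ C CM A.
split=> -[gC gi gf]; split=> // A CA; have mA := mC A CA; have := gf A CA.
  by rewrite !integral_setE // => -[].
by rewrite !integral_setE // => ->.
Qed.

Lemma condexp_integrable C f : C `<=` measurable -> P.-integrable setT (EFin \o f) ->
  P.-integrable setT (EFin \o condexp P <<s C >> f).
Proof. by move=> CM /(condexpP CM)[]. Qed.

Lemma condexp_sub_sigma C f : C `<=` measurable -> P.-integrable setT (EFin \o f) ->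
  g_sigma_algebra_preimage (condexp P <<s C >> f) `<=` <<s C >>.
Proof. by move=> CM /(condexpP CM)[]. Qed.

Lemma Rintegral_indic_condexp C f A : C `<=` measurable ->
  P.-integrable setT (EFin \o f) -> <<s C >> A ->
  \int[P]_x (\1_A x * condexp P <<s C >> f x) = \int[P]_x (\1_A x * f x).
Proof.
by move=> CM fi CA; have /(is_condexpP _ CM fi)[_ _] := condexpP CM fi; exact.
Qed.

Lemma condexp_unique C f g : setI_closed C -> C setT -> C `<=` measurable ->
  P.-integrable setT (EFin \o f) -> P.-integrable setT (EFin \o g) ->
  g_sigma_algebra_preimage g `<=` <<s C >> ->
  (forall A, C A -> \int[P]_x (\1_A x * g x) = \int[P]_x (\1_A x * f x)) ->
  condexp P <<s C >> f = g %[ae P].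
Proof.
move=> CI CT CM fi gi gC gf; apply: (ae_eq_sub_sigma CI) => //.
- exact: condexp_integrable.
- exact: condexp_sub_sigma.
- move=> A CA; rewrite Rintegral_indic_condexp ?gf//; exact: sub_sigma_algebra.
Qed.

Lemma eq_Rintegral_ae f g : measurable_fun setT f -> measurable_fun setT g ->
  f = g %[ae P] -> \int[P]_x f x = \int[P]_x g x.
Proof.
move=> mf mg fg; congr fine; apply: ae_eq_integral => //.
- exact/measurable_EFinP.
- exact/measurable_EFinP.
- by apply: filterS fg => x /(_ I) -> _.
Qed.

(** An equality of functions, not only almost everywhere: the defining property
    of a version only depends on the integrals of f, so f and g have the same
    set of versions, from which the same element is chosen. *)
Lemma condexp_ae G f g : measurable_fun setT f -> measurable_fun setT g ->
  G `<=` measurable -> f = g %[ae P] -> condexp P G f = condexp P G g.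
Proof.
move=> mf mg GM fg; rewrite /condexp; congr (xget _ _); apply/seteqP.
have E A : G A -> (\int[P]_(x in A) (f x)%:E = \int[P]_(x in A) (g x)%:E)%E.
  move=> GA; apply: ae_eq_integral; [exact: GM|by apply/measurable_funTS/measurable_EFinP..|].
  by apply: filterS fg => x /(_ I) ->.
by split=> Y [? ? YE]; split=> // A GA; rewrite YE// E.
Qed.

End conditional_expectation_theory.

(** * Square-integrable functions *)

Section square_integrable.
Context d (T : measurableType d) (R : realType).
Variable P : probability T R.
Implicit Types (f g h : T -> R) (A : set T) (C : set (set T)).

(** Conditional expectation is self-adjoint: f minus its conditional expectation
    is orthogonal to every <<s C >>-measurable g. *)
Lemma Rintegral_mul_condexp C f g : setI_closed C -> C setT -> C `<=` measurable ->
  P.-integrable setT (EFin \o f) ->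
  g_sigma_algebra_preimage g `<=` <<s C >> ->
  P.-integrable setT (EFin \o (fun x => g x * f x)) ->
  P.-integrable setT (EFin \o (fun x => g x * condexp P <<s C >> f x)) ->
  \int[P]_x (g x * condexp P <<s C >> f x) = \int[P]_x (g x * f x).
Proof.
move=> CI CT CM fi gC gfi gei.
have ei := condexp_integrable CM fi.
have E (k : T -> R) : (fun x => k x * (-1 * f x + condexp P <<s C >> f x)) =
    fun x => -1 * (k x * f x) + k x * condexp P <<s C >> f x.
  by apply/funext => x; rewrite mulrDr mulrCA.
apply/eqP; rewrite -subr_eq0 addrC -mulN1r -Rintegral_lin// -E.
apply/eqP; apply: (integral_mul_eq0 CI) => //.
- exact: integrable_lin.
- move=> A CA; have mA := CM _ CA.
  rewrite E Rintegral_lin ?Rintegral_indic_condexp ?mulN1r ?addNr//.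
  + exact: sub_sigma_algebra.
  + exact: integrable_indicM.
  + exact: integrable_indicM.
- by rewrite E; exact: integrable_lin.
Qed.

Lemma Lfun2P f : f \in Lfun P 2%:E <->
  measurable_fun setT f /\ P.-integrable setT (EFin \o (fun x => f x ^+ 2)).
Proof.
split=> [fL|[mf fi]].
  split; last exact: Lfun2_integrable_sqr.
  by move: fL; rewrite inE => /andP[/[!inE]].
rewrite inE; apply/andP; split; rewrite inE//=.
rewrite /finite_norm unlock /Lnorm poweR_lty//.
case/integrableP : fi => _; congr (_ < _)%E; apply: eq_integral => x _ /=.
by rewrite powR_mulrn// normrX.
Qed.

Lemma Lfun2_measurable f : f \in Lfun P 2%:E -> measurable_fun setT f.
Proof. by case/Lfun2P. Qed.

Lemma Lfun2_integrable f : f \in Lfun P 2%:E -> P.-integrable setT (EFin \o f).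
Proof.
move=> f2; apply/Lfun1_integrable; apply: Lfun_subset12 f2.
exact: fin_num_measure.
Qed.

Lemma Lfun2_mul_integrable f g : f \in Lfun P 2%:E -> g \in Lfun P 2%:E ->
  P.-integrable setT (EFin \o (fun x => f x * g x)).
Proof. by move=> f2 g2; apply/Lfun1_integrable; exact: Lfun2_mul_Lfun1. Qed.

Lemma Lfun2_lin a f g : f \in Lfun P 2%:E -> g \in Lfun P 2%:E ->
  (fun x => a * f x + g x) \in Lfun P 2%:E.
Proof.
move=> f2 g2; have p1 : (1 <= 2%:E :> \bar R)%E by rewrite lee_fin ler1n.
exact: (Lfun_submod_closed P p1).2.
Qed.

Lemma Lfun2_le f g : measurable_fun setT f -> g \in Lfun P 2%:E ->
  (forall x, `|f x| <= `|g x|) -> f \in Lfun P 2%:E.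
Proof.
move=> mf /Lfun2P[mg gi] fg; apply/Lfun2P; split=> //.
apply: integrable_le gi _; first exact: measurable_funX.
by move=> x; rewrite !normrX lerXn2r ?nnegrE.
Qed.

Lemma Lfun2_norm f : f \in Lfun P 2%:E -> (fun x => `|f x|) \in Lfun P 2%:E.
Proof.
move=> f2; apply: (Lfun2_le _ f2) => [|x]; last by rewrite normr_id.
exact: measurableT_comp (Lfun2_measurable f2).
Qed.

Lemma Lfun2_indic A : measurable A -> (\1_A : T -> R) \in Lfun P 2%:E.
Proof.
move=> mA; apply: (@Lfun2_le _ (cst 1)); first exact: measurable_indic.
  exact: Lfun_cst.
by move=> x; rewrite indicE normr1 ger0_norm// lern1 leq_b1.
Qed.

(** Conditional expectation is an L^2 contraction.  With e the conditional
    expectation of f and t_n its truncation to {|e| <= n}, self-adjointness and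
    2 t_n f <= t_n^2 + f^2 give \int t_n^2 = \int t_n e = \int t_n f
    <= (\int t_n^2 + \int f^2) / 2, so that \int t_n^2 <= \int f^2; monotone
    convergence concludes. *)
Lemma condexp_Lfun2 C f : setI_closed C -> C setT -> C `<=` measurable ->
  f \in Lfun P 2%:E -> condexp P <<s C >> f \in Lfun P 2%:E.
Proof.
move=> CI CT CM f2; have fi := Lfun2_integrable f2.
have ei := condexp_integrable CM fi.
have eC := condexp_sub_sigma CM fi.
set e := condexp P <<s C >> f in ei eC *.
have me := integrable_measurable ei.
pose B n := [set x | `|e x| <= n%:R].
have CB n : <<s C >> (B n).
  rewrite (_ : B n = e @^-1` `[- n%:R, n%:R]%classic).
    by apply: eC; exists (`[- n%:R, n%:R]%classic); rewrite ?setTI.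
  by apply/seteqP; split=> x; rewrite /B/= in_itv/= ler_norml.
have mB n : measurable (B n) by exact: (sub_g_sigma_measurable CM).
pose t n x := \1_(B n) x * e x.
have t2 n : t n \in Lfun P 2%:E.
  apply: (@Lfun2_le _ (cst n%:R)); last 1 first.
  - move=> x; rewrite /t indicE; have [xB|xB] := boolP (x \in B n).
      by move: xB; rewrite inE mul1r [leRHS]ger0_norm.
    by rewrite mul0r normr0.
  - by apply: measurable_funM => //; exact: measurable_indic.
  - exact: Lfun_cst.
have tC n : g_sigma_algebra_preimage (t n) `<=` <<s C >>.
  by apply: preimage_mul => //; exact: preimage_indic.
have tte n : (fun x => t n x * e x) = fun x => t n x ^+ 2.
  apply/funext => x; rewrite /t indicE.
  by case: (_ \in _); rewrite ?mul1r ?expr2 ?mul0r.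
have le n : \int[P]_x (t n x ^+ 2) <= \int[P]_x (f x ^+ 2).
  have ti := Lfun2_integrable_sqr (t2 n).
  have f2i := Lfun2_integrable_sqr f2.
  have tfi := Lfun2_mul_integrable (t2 n) f2.
  have H : \int[P]_x (t n x ^+ 2) = \int[P]_x (t n x * f x).
    by rewrite -tte Rintegral_mul_condexp// -/e tte.
  suff : 2 * \int[P]_x (t n x * f x) <= \int[P]_x (t n x ^+ 2) + \int[P]_x (f x ^+ 2).
    by rewrite -H mulr_natl mulr2n lerD2l.
  have -> : 2 * \int[P]_x (t n x * f x) = \int[P]_x (2 * (t n x * f x)).
    by rewrite RintegralZl.
  rewrite -[X in _ <= X + _]mul1r -Rintegral_lin//; apply: le_Rintegral => //.
  + by have := integrableZl measurableT 2 tfi; apply: eq_integrable.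
  + exact: integrable_lin.
  + move=> x _; rewrite mul1r -subr_ge0.
    rewrite (_ : _ - _ = (t n x - f x) ^+ 2) ?sqr_ge0// sqrrB mulr_natl.
    by rewrite addrAC.
apply/Lfun2P; split => //.
apply/integrableP; split; first by apply/measurable_EFinP; exact: measurable_funX.
rewrite (_ : \int[P]_x _ = \int[P]_x limn (fun n => (t n x ^+ 2)%:E))%E; last first.
  apply: eq_integral => x _; rewrite /= ger0_norm ?sqr_ge0//; apply/esym/cvg_lim => //.
  apply: cvg_near_cst; exists (Num.trunc `|e x|).+1 => // n /= xn.
  rewrite /t indicE mem_set ?mul1r// /B/=.
  by apply: le_trans (ltW (truncnS_gt _)) _; rewrite ler_nat.
apply: (@le_lt_trans _ _ (\int[P]_x (f x ^+ 2))%:E); last exact: ltry.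
have cv := @cvg_monotone_convergence _ _ _ P _ measurableT (fun n x => (t n x ^+ 2)%:E).
apply: (cvge_to_le (cv _ _ _)).
- move=> n; apply/measurable_EFinP; apply: measurable_funX; exact: Lfun2_measurable.
- by move=> n x _; rewrite lee_fin sqr_ge0.
- move=> x _ m n mn; rewrite lee_fin !exprMn ler_wpM2r ?sqr_ge0//.
  rewrite !indicE; have [xB|] := boolP (x \in B m); last by rewrite expr0n/= sqr_ge0.
  rewrite mem_set//; move: xB; rewrite inE /B/= => /le_trans; apply.
  by rewrite ler_nat.
- apply: nearW => n; move: (le n); rewrite -lee_fin {1}/Rintegral fineK//.
  exact: integrable_fin_num (Lfun2_integrable_sqr (t2 n)).
Qed.

End square_integrable.

(** * Cylinders and independence *)

Section cylinders.
Context d (T : measurableType d) (R : realType).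
Variable P : probability T R.
Context (dE : nat -> measure_display) (E : forall n, measurableType (dE n)).
Variable X : forall n, {RV P >-> E n}.
Implicit Types (f g h : T -> R) (A : set T) (K L M : set nat).
Implicit Types (J : {fset nat}) (S : nat -> set T).

(** The constraints S n are taken as events of T rather than as subsets of the
    state spaces E n, so that they can be combined without dependent types. *)
Definition cylinder M : set (set T) :=
  [set A | exists J S, [/\ [set` J] `<=` M,
     forall n, g_sigma_algebra_preimage (X n) (S n) &
     A = \bigcap_(n in [set` J]) S n]].

Lemma preimageX_setT n : g_sigma_algebra_preimage (X n) [set: T].
Proof. by exists setT => //; rewrite preimage_setT setTI. Qed.

Lemma preimageX_setI n A B : g_sigma_algebra_preimage (X n) A ->
  g_sigma_algebra_preimage (X n) B -> g_sigma_algebra_preimage (X n) (A `&` B).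
Proof.
move=> [A' mA' <-] [B' mB' <-]; exists (A' `&` B'); first exact: measurableI.
by rewrite !setTI preimage_setI.
Qed.

Lemma preimageX_measurable n A : g_sigma_algebra_preimage (X n) A -> measurable A.
Proof. by move=> [B mB <-]; rewrite setTI; exact: measurable_funPTI. Qed.

Lemma cylinder_setT M : cylinder M setT.
Proof.
exists fset0, (fun=> setT); split; first by move=> n /=; rewrite inE.
  by move=> n; exact: preimageX_setT.
by rewrite set_fset0 bigcap_set0.
Qed.

Lemma cylinder_setI M : setI_closed (cylinder M).
Proof.
move=> _ _ [J1 [S1 [JM1 XS1 ->]]] [J2 [S2 [JM2 XS2 ->]]].
exists (J1 `|` J2)%fset, (fun n => (if n \in J1 then S1 n else setT) `&`
                              (if n \in J2 then S2 n else setT)); split.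
- by move=> n /=; rewrite in_fsetU => /orP[/JM1|/JM2].
- move=> n; apply: preimageX_setI; case: ifP => _; try exact: preimageX_setT.
    exact: XS1.
  exact: XS2.
- apply/seteqP; split=> [x [x1 x2] n _|x xS].
    by split; case: ifPn => // nJ; [exact: x1|exact: x2].
  split=> n nJ; have := xS n; rewrite /= in_fsetU nJ ?orbT => /(_ isT) [].
    by [].
  by [].
Qed.

Lemma cylinder_measurable M : cylinder M `<=` measurable.
Proof.
move=> _ [J [S [_ XS ->]]]; apply: fin_bigcap_measurable => // n _.
exact: preimageX_measurable (XS n).
Qed.

(** The cylinders over M form a pi-system generating sigma(X_j : j in M); this is
    what makes the general lemmas on conditional expectations applicable to
    [sigmaX]. *)
Lemma sigmaX_cylinder M : sigmaX X M = <<s cylinder M >>.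
Proof.
rewrite /sigmaX; apply/seteqP; split.
  apply: sub_smallest2r; first exact: smallest_sigma_algebra.
  move=> A [n Mn XA].
  exists [fset n]%fset, (fun m => if m == n then A else setT).
  split.
  - by move=> m /=; rewrite inE => /eqP ->.
  - by move=> m; case: eqP => [->//|_]; exact: preimageX_setT.
  - by rewrite set_fset1 bigcap_set1 eqxx.
apply: smallest_sub; first exact: smallest_sigma_algebra.
move=> _ [J [S [JM XS ->]]].
set C := \bigcup_(j in M) _.
apply: (@fin_bigcap_measurable _ (g_sigma_algebraType C)) => // n Jn.
by apply: sub_sigma_algebra; exists n => //; exact: JM.
Qed.

Lemma sub_cylinder L M : L `<=` M -> cylinder L `<=` cylinder M.
Proof.
by move=> LM A [J [S [JL XS ->]]]; exists J, S; split => // n /JL /LM.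
Qed.

Hypothesis indX : mutually_independent P X.

Lemma cylinder_prod J S : (forall n, g_sigma_algebra_preimage (X n) (S n)) ->
  P (\bigcap_(n in [set` J]) S n) = (\prod_(n <- J) P (S n))%E.
Proof.
move=> XS.
have BP n : exists B : set (E n), measurable B /\ X n @^-1` B = S n.
  by have [B mB <-] := XS n; exists B; rewrite setTI.
pose B n := sval (cid (BP n)).
have BE n : X n @^-1` B n = S n by rewrite /B; case: cid => ? [].
have := @indX J B; under eq_bigcapr do rewrite BE; move=> -> //.
  by apply: eq_bigr => n _; rewrite BE.
by move=> n _; rewrite /B; case: cid => ? [].
Qed.

(** Glue the two families of constraints along the union of the disjoint index
    sets and split the product given by mutual independence. *)
Lemma cylinder_independent L M A B : L `&` M = set0 ->
  cylinder L A -> cylinder M B -> P (A `&` B) = (P A * P B)%E.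
Proof.
move=> LM [J1 [S1 [JL XS1 ->]]] [J2 [S2 [JM XS2 ->]]].
have J12 n : n \in J1 -> n \notin J2.
  move=> n1; apply/negP => n2; have : (L `&` M) n by split; [exact: JL|exact: JM].
  by rewrite LM.
pose S n := if n \in J1 then S1 n else S2 n.
have -> : \bigcap_(n in [set` J1]) S1 n `&` \bigcap_(n in [set` J2]) S2 n =
    \bigcap_(n in [set` (J1 `|` J2)%fset]) S n.
  apply/seteqP; split=> [x [x1 x2] n|x xS].
    rewrite /= in_fsetU /S; case: ifPn => [nJ _|_ /= nJ]; [exact: x1|exact: x2].
  split=> n nJ; have := xS n; rewrite /= in_fsetU nJ ?orbT => /(_ isT); rewrite /S.
    by rewrite nJ.
  by case: ifPn => // /J12; rewrite nJ.
rewrite !cylinder_prod//; last by move=> n; rewrite /S; case: ifP.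
rewrite (big_fsetID _ (mem J1))/=; congr (_ * _)%E.
  rewrite (_ : [fset _ | _ in _ & _]%fset = J1).
    by apply: eq_big_seq => n; rewrite /S => ->.
  by apply/fsetP => n; rewrite !inE/=; case: (_ \in J1); rewrite ?andbF.
rewrite (_ : [fset _ | _ in _ & _]%fset = J2).
  by apply: eq_big_seq => n n2; rewrite /S; case: ifPn => // /J12; rewrite n2.
apply/fsetP => n; rewrite !inE/=; have := J12 n.
by case: (n \in J1) => [/(_ isT)|]; rewrite ?andbF ?andbT//= => /negbTE.
Qed.

End cylinders.

(** * Conditioning on a family of coordinates *)

Section condexp_sigmaX.
Context d (T : measurableType d) (R : realType).
Variable P : probability T R.
Context (dE : nat -> measure_display) (E : forall n, measurableType (dE n)).
Variable X : forall n, {RV P >-> E n}.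
Implicit Types (f g h : T -> R) (A : set T) (K L M : set nat).

Local Notation CE M := (condexp P (sigmaX X M)).

Lemma condexpX_integrable M f : P.-integrable setT (EFin \o f) ->
  P.-integrable setT (EFin \o CE M f).
Proof.
by rewrite sigmaX_cylinder => /condexp_integrable; apply; exact: cylinder_measurable.
Qed.

Lemma condexpX_sub_sigma M f : P.-integrable setT (EFin \o f) ->
  g_sigma_algebra_preimage (CE M f) `<=` sigmaX X M.
Proof.
by rewrite sigmaX_cylinder => /condexp_sub_sigma; apply; exact: cylinder_measurable.
Qed.

Lemma condexpX_Lfun2 M f : f \in Lfun P 2%:E -> CE M f \in Lfun P 2%:E.
Proof.
rewrite sigmaX_cylinder; apply: condexp_Lfun2.
- exact: cylinder_setI.
- exact: cylinder_setT.
- exact: cylinder_measurable.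
Qed.

Lemma Rintegral_indic_condexpX M f A : P.-integrable setT (EFin \o f) -> cylinder X M A ->
  \int[P]_x (\1_A x * CE M f x) = \int[P]_x (\1_A x * f x).
Proof.
move=> fi MA; rewrite sigmaX_cylinder Rintegral_indic_condexp//.
  exact: cylinder_measurable.
exact: sub_sigma_algebra.
Qed.

Lemma Rintegral_mul_condexpX M f g : f \in Lfun P 2%:E -> g \in Lfun P 2%:E ->
  g_sigma_algebra_preimage g `<=` sigmaX X M ->
  \int[P]_x (g x * CE M f x) = \int[P]_x (g x * f x).
Proof.
move=> f2 g2; rewrite sigmaX_cylinder => gM; apply: Rintegral_mul_condexp => //.
- exact: cylinder_setI.
- exact: cylinder_setT.
- exact: cylinder_measurable.
- exact: Lfun2_integrable.
- exact: Lfun2_mul_integrable.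
- by apply: Lfun2_mul_integrable => //; rewrite -sigmaX_cylinder; exact: condexpX_Lfun2.
Qed.

Lemma sub_sigmaX L M : L `<=` M -> sigmaX X L `<=` sigmaX X M.
Proof.
move=> LM; rewrite !sigmaX_cylinder; apply: sub_smallest2r.
  exact: smallest_sigma_algebra.
exact: sub_cylinder.
Qed.

Lemma condexpX_unique M f g : P.-integrable setT (EFin \o f) ->
  P.-integrable setT (EFin \o g) ->
  g_sigma_algebra_preimage g `<=` sigmaX X M ->
  (forall A, cylinder X M A -> \int[P]_x (\1_A x * g x) = \int[P]_x (\1_A x * f x)) ->
  CE M f = g %[ae P].
Proof.
move=> fi gi; rewrite sigmaX_cylinder => gM gf; apply: condexp_unique gf => //.
- exact: cylinder_setI.
- exact: cylinder_setT.
- exact: cylinder_measurable.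
Qed.

Lemma condexpX_id M f : P.-integrable setT (EFin \o f) ->
  g_sigma_algebra_preimage f `<=` sigmaX X M -> CE M f = f %[ae P].
Proof. by move=> fi fM; apply: condexpX_unique. Qed.

Lemma condexpX_lin M a f g : P.-integrable setT (EFin \o f) ->
  P.-integrable setT (EFin \o g) ->
  CE M (fun x => a * f x + g x) = (fun x => a * CE M f x + CE M g x) %[ae P].
Proof.
move=> fi gi; have fgi := integrable_lin a fi gi.
have fei := condexpX_integrable M fi; have gei := condexpX_integrable M gi.
apply: condexpX_unique => //; first exact: integrable_lin.
  have := condexpX_sub_sigma (M := M).
  by rewrite sigmaX_cylinder => s; apply: preimage_lin; exact: s.
move=> A MA; have mA := cylinder_measurable MA.
have D (h k : T -> R) : (fun x => \1_A x * (a * h x + k x)) =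
    (fun x => a * (\1_A x * h x) + \1_A x * k x).
  by apply/funext => x; rewrite mulrDr mulrCA.
by rewrite !D !Rintegral_lin ?Rintegral_indic_condexpX//; exact: integrable_indicM.
Qed.

Lemma condexpX_ae M f g : measurable_fun setT f -> measurable_fun setT g ->
  f = g %[ae P] -> CE M f = CE M g.
Proof.
move=> mf mg; apply: condexp_ae => //; rewrite sigmaX_cylinder.
exact/sub_g_sigma_measurable/cylinder_measurable.
Qed.

Hypothesis indX : mutually_independent P X.

Lemma Rintegral_indic A : measurable A -> \int[P]_x \1_A x = fine (P A).
Proof. by move=> mA; rewrite /Rintegral integral_indic ?setIT. Qed.

(** The only place where independence enters.  Put h := E[f | K & L] - E[f | L]; it
    has to be shown that h integrates to 0 over every cylinder A over K.  Write
    A = A1 & A2, where A1 collects the constraints on indices in L and A2 those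
    on indices outside L.  Since 1_{A1} h depends on L only and A2 is independent
    of L, the integral of h over A is P(A2) times its integral over A1, and the
    latter vanishes because A1 is a cylinder over K & L. *)
Lemma condexpX_condexpX K L f : P.-integrable setT (EFin \o f) ->
  CE K (CE L f) = CE (K `&` L) f %[ae P].
Proof.
move=> fi; have zi := condexpX_integrable L fi.
have wi := condexpX_integrable (K `&` L) fi.
apply: condexpX_unique => //.
  by apply: subset_trans (condexpX_sub_sigma fi) _; apply: sub_sigmaX => n [].
pose h x := -1 * CE L f x + CE (K `&` L) f x.
have hi : P.-integrable setT (EFin \o h) by exact: integrable_lin.
have hL : g_sigma_algebra_preimage h `<=` sigmaX X L.
  rewrite [sigmaX X L]sigmaX_cylinder; apply: preimage_lin; rewrite -sigmaX_cylinder.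
    exact: condexpX_sub_sigma.
  by apply: subset_trans (condexpX_sub_sigma fi) _; apply: sub_sigmaX => n [].
move=> A KA; have mA := cylinder_measurable KA.
have D B : (fun x => \1_B x * h x) =
    (fun x => -1 * (\1_B x * CE L f x) + \1_B x * CE (K `&` L) f x).
  by apply/funext => x; rewrite mulrDr mulrCA.
apply/eqP; rewrite -subr_eq0 addrC -mulN1r -Rintegral_lin; [|exact: integrable_indicM..].
rewrite -D; apply/eqP.
case: KA => [J [S [JK XS AE]]].
pose J1 := [fset n in J | n \in L]%fset; pose J2 := [fset n in J | n \notin L]%fset.
pose A1 := \bigcap_(n in [set` J1]) S n; pose A2 := \bigcap_(n in [set` J2]) S n.
have A12 : A = A1 `&` A2.
  rewrite AE; apply/seteqP; split=> [x xS|x [x1 x2] n /= nJ].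
    by split=> n /=; rewrite !inE => /andP[nJ _]; exact: xS.
  have [nL|nL] := boolP (n \in L).
    by apply: x1; rewrite /= !inE nJ.
  by apply: x2; rewrite /= !inE nJ.
have C1 : cylinder X (K `&` L) A1.
  exists J1, S; split => // n /=; rewrite !inE => /andP[/JK Kn nL].
  by split => //; exact: set_mem.
have C2 : cylinder X (~` L) A2.
  exists J2, S; split => // n /=; rewrite !inE => /andP[_ /negP nL] Ln.
  by apply: nL; exact: mem_set.
have m1 := cylinder_measurable C1; have m2 := cylinder_measurable C2.
have h1 : \int[P]_x (\1_A1 x * h x) = 0.
  rewrite D Rintegral_lin; [|exact: integrable_indicM..].
  rewrite !Rintegral_indic_condexpX ?mulN1r ?addNr//.
  by apply: sub_cylinder C1 => n [].
pose p := fine (P A2).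
have i1 := integrable_indicM m1 hi.
(* k is the centered indicator of A2, orthogonal to every cylinder over L *)
pose k x := - p * cst 1 x + \1_A2 x.
have ki : P.-integrable setT (EFin \o k).
  by apply: integrable_lin; [exact: integrable_cst|exact: integrable_indic].
have k1 : (fun x => \1_A1 x * h x * k x) =
    fun x => - p * (\1_A1 x * h x) + \1_A x * h x.
  by apply/funext => x; rewrite A12 indicI/= /k /cst; ring.
have i2 : P.-integrable setT (EFin \o (fun x => \1_A1 x * h x * k x)).
  by rewrite k1; apply: integrable_lin => //; exact: integrable_indicM.
suff : \int[P]_x (\1_A1 x * h x * k x) = 0.
  by rewrite k1 Rintegral_lin ?h1 ?mulr0 ?add0r//; exact: integrable_indicM.
apply: (@integral_mul_eq0 _ _ _ P (cylinder X L)) => //.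
- exact: cylinder_setI.
- exact: cylinder_setT.
- exact: cylinder_measurable.
- move=> B LB; have mB := cylinder_measurable LB.
  have -> : (fun x => \1_B x * k x) = fun x => - p * \1_B x + \1_(B `&` A2) x :> R.
    by apply/funext => x; rewrite indicI/= /k /cst; ring.
  have mBA2 : measurable (B `&` A2) by exact: measurableI.
  rewrite Rintegral_lin; [|exact: integrable_indic..].
  rewrite !Rintegral_indic//.
  rewrite (cylinder_independent indX _ LB C2) ?setICr//.
  by rewrite fineM ?fin_num_measure// mulNr mulrC addNr.
- apply: preimage_mul.
    apply: preimage_indic; apply: sub_sigma_algebra.
    by apply: sub_cylinder C1 => n [].
  by rewrite -sigmaX_cylinder.
Qed.

End condexp_sigmaX.

(** * Alternating sums over finite sets *)

Section toggle.
Implicit Types (j : nat) (L M : {fset nat}).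
Local Open Scope fset_scope.

(** The symmetric difference of L with the singleton of j. *)
Definition toggle j L : {fset nat} := if j \in L then L `\ j else j |` L.

Lemma in_toggle j L i : (i \in toggle j L) = (i == j) (+) (i \in L).
Proof.
by rewrite /toggle; case: ifPn => jL; rewrite !inE; case: eqP => [->|_] //=;
  rewrite ?jL// (negbTE jL).
Qed.

Lemma toggleK j : involutive (toggle j).
Proof. by move=> L; apply/fsetP => i; rewrite !in_toggle addbA addbb. Qed.

Lemma odd_toggle j L : odd #|` toggle j L| = ~~ odd #|` L|.
Proof.
rewrite /toggle; case: ifPn => jL; last by rewrite cardfsU1 jL oddD.
by rewrite [in RHS](cardfsD1 j) jL oddD negbK.
Qed.

Lemma toggle_sub j L M : j \in M -> L `<=` M -> toggle j L `<=` M.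
Proof.
move=> jM /fsubsetP LM; apply/fsubsetP => i; rewrite in_toggle.
by case: eqP => [->//|_ /LM].
Qed.

(** The involution L |-> toggle j L pairs terms of opposite signs. *)
Lemma sum_toggle_eq0 (R : realFieldType) (s : seq {fset nat}) j (h : {fset nat} -> R) :
  uniq s -> {in s, forall L, toggle j L \in s} ->
  {in s, forall L, h (toggle j L) = - h L} -> (\sum_(L <- s) h L = 0)%R.
Proof.
move=> us st ht; have ps : perm_eq s (map (toggle j) s).
  have ut : uniq (map (toggle j) s) by rewrite map_inj_uniq//; exact/inv_inj/toggleK.
  apply: uniq_perm => // L; apply/idP/mapP => [Ls|[K Ks ->]]; last exact: st.
  by exists (toggle j L); [exact: st|rewrite toggleK].
have E : (\sum_(L <- s) h L = - \sum_(L <- s) h L)%R.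
  by rewrite {1}(perm_big _ ps) big_map -sumrN big_seq [RHS]big_seq; exact: eq_bigr.
by lra.
Qed.

Lemma sign_toggle (R : realFieldType) j L M : j \in M -> L `<=` M ->
  ((-1) ^+ (#|` M| - #|` toggle j L|) = - (-1) ^+ (#|` M| - #|` L|) :> R)%R.
Proof.
move=> jM LM; rewrite -signr_odd -[in RHS]signr_odd.
rewrite !oddB ?fsubset_leq_card ?toggle_sub// odd_toggle addbN.
by case: (_ (+) _) => //=; rewrite ?expr0 ?expr1 ?opprK.
Qed.

Lemma alternating_sum_eq0 (R : realFieldType) j M (c : {fset nat} -> R) :
  j \in M -> (forall L, c (toggle j L) = c L) ->
  (\sum_(L <- fpowerset M) (-1) ^+ (#|` M| - #|` L|) * c L = 0)%R.
Proof.
move=> jM ct; apply: (@sum_toggle_eq0 _ _ j); first exact: fset_uniq.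
all: move=> L; rewrite fpowersetE => LM.
  by rewrite fpowersetE toggle_sub.
by rewrite sign_toggle// ct mulNr.
Qed.

(** After exchanging the sums, the coefficient of c L is the alternating sum over
    the interval from L to M; for L <> M it vanishes by toggling an element of
    M that is not in L. *)
Lemma moebius_inversion (R : realFieldType) M (c : {fset nat} -> R) :
  (\sum_(K <- fpowerset M) \sum_(L <- fpowerset K) (-1) ^+ (#|` K| - #|` L|) * c L
    = c M)%R.
Proof.
transitivity (\sum_(K <- fpowerset M) \sum_(L <- fpowerset M | L `<=` K)
    (-1) ^+ (#|` K| - #|` L|) * c L)%R.
  apply: eq_big_seq => K; rewrite fpowersetE => KM; rewrite [RHS]big_fset_condE.
  apply: eq_fbigl => L; rewrite !inE !fpowersetE.
  by apply/idP/andP => [LK|[]//]; split => //; exact: fsubset_trans KM.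
rewrite (exchange_big_dep predT)//= (big_fsetD1 M) ?fpowersetE//=.
rewrite [X in (X + _)%R](_ : _ = c M).
  rewrite big_seq big1 ?addr0// => L; rewrite !inE fpowersetE => /andP[LM LsubM].
  have [j jM jL] : exists2 j, j \in M & j \notin L.
    apply/fsubsetPn; apply: contra LM => MsubL.
    by rewrite eqEfsubset LsubM.
  rewrite -mulr_suml [X in (X * _)%R](_ : _ = 0)%R ?mul0r//.
  rewrite -big_filter; apply: (@sum_toggle_eq0 _ _ j); first by rewrite filter_uniq ?fset_uniq.
    move=> K; rewrite !mem_filter !fpowersetE => /andP[/fsubsetP LK KM].
    rewrite toggle_sub// andbT; apply/fsubsetP => i iL; rewrite in_toggle LK// addbT.
    by apply: contraNN jL => /eqP <-.
  move=> K; rewrite mem_filter fpowersetE => /andP[LK KM].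
  rewrite -signr_odd -[in RHS]signr_odd !oddB ?fsubset_leq_card//.
    by rewrite odd_toggle addNb; case: (_ (+) _) => //=; rewrite ?expr0 ?expr1 ?opprK.
  apply/fsubsetP => i iL; rewrite in_toggle (fsubsetP LK)// addbT.
  by apply: contraNN jL => /eqP <-.
rewrite big_fset_condE (_ : [fset _ | _ in _ & _] = [fset M]).
  by rewrite big_seq_fset1 subnn expr0 mul1r.
by apply/fsetP => K; rewrite !inE fpowersetE eqEfsubset.
Qed.

End toggle.

(** * Hoeffding components *)

Section hoeffding_components.
Context d (T : measurableType d) (R : realType).
Variable P : probability T R.
Context (dE : nat -> measure_display) (E : forall n, measurableType (dE n)).
Variable X : forall n, {RV P >-> E n}.
Implicit Types (f g h : T -> R) (A : set T) (K L M N : {fset nat}).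

Local Notation CE M := (condexp P (sigmaX X M)).
Local Notation component := (hoeffding_component P X).

Section finite_sums.
Variables (iT : eqType) (s : seq iT) (c : iT -> R) (u v : iT -> T -> R).

Lemma Lfun2_sum : {in s, forall i, u i \in Lfun P 2%:E} ->
  (fun t => \sum_(i <- s) c i * u i t) \in Lfun P 2%:E.
Proof.
elim: s => [|i r IH] u2; first by under eq_fun do rewrite big_nil; exact: Lfun_cst.
under eq_fun do rewrite big_cons; apply: Lfun2_lin.
  by apply: u2; rewrite mem_head.
by apply: IH => j jr; apply: u2; rewrite in_cons jr orbT.
Qed.

Lemma preimage_sum C :
  {in s, forall i, g_sigma_algebra_preimage (u i) `<=` <<s C >>} ->
  g_sigma_algebra_preimage (fun t => \sum_(i <- s) c i * u i t) `<=` <<s C >>.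
Proof.
elim: s => [|i r IH] uC; first by under eq_fun do rewrite big_nil; exact: preimage_cst.
under eq_fun do rewrite big_cons; apply: preimage_lin.
  by apply: uC; rewrite mem_head.
by apply: IH => j jr; apply: uC; rewrite in_cons jr orbT.
Qed.

Lemma Rintegral_sum_mul g : {in s, forall i, u i \in Lfun P 2%:E} ->
  g \in Lfun P 2%:E ->
  \int[P]_x ((\sum_(i <- s) c i * u i x) * g x) =
  \sum_(i <- s) c i * \int[P]_x (u i x * g x).
Proof.
move=> u2 g2; have i2 : {in s, forall i, P.-integrable setT (EFin \o (fun x => u i x * g x))}.
  by move=> i /u2 ui; exact: Lfun2_mul_integrable.
transitivity (\int[P]_x (\sum_(i <- s) c i * (u i x * g x))).
  congr (Rintegral _ _ _); apply/funext => x; rewrite mulr_suml.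
  by apply: eq_bigr => i _; rewrite mulrA.
suff [] : P.-integrable setT (EFin \o (fun x => \sum_(i <- s) c i * (u i x * g x))) /\
  \int[P]_x (\sum_(i <- s) c i * (u i x * g x)) =
  \sum_(i <- s) c i * \int[P]_x (u i x * g x) by [].
elim: s i2 => [|i r IH] i2.
  rewrite big_nil; split; first by under eq_fun do rewrite big_nil; exact: integrable_cst.
  by under eq_Rintegral do rewrite big_nil; rewrite Rintegral_cst// mul0r.
have [j|ri rE] := IH; first by move=> jr; apply: i2; rewrite in_cons jr orbT.
have ii : P.-integrable setT (EFin \o (fun x => u i x * g x)) by apply: i2; rewrite mem_head.
have SE : (fun x => \sum_(j <- i :: r) c j * (u j x * g x)) =
    fun x => c i * (u i x * g x) + \sum_(j <- r) c j * (u j x * g x).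
  by apply/funext => x; rewrite big_cons.
rewrite SE; split; first exact: integrable_lin.
by rewrite Rintegral_lin// rE big_cons.
Qed.

Lemma ae_eq_sum : {in s, forall i, u i = v i %[ae P]} ->
  (fun t => \sum_(i <- s) c i * u i t) = (fun t => \sum_(i <- s) c i * v i t) %[ae P].
Proof.
elim: s => [|i r IH] uv; first by apply/aeW => x _; rewrite !big_nil.
have ui : u i = v i %[ae P] by apply: uv; rewrite mem_head.
have ur : (fun t => \sum_(i <- r) c i * u i t) = (fun t => \sum_(i <- r) c i * v i t) %[ae P].
  by apply: IH => j jr; apply: uv; rewrite in_cons jr orbT.
by apply: filterS2 ui ur => x /(_ I) ui /(_ I) ur _; rewrite !big_cons ui ur.
Qed.

End finite_sums.

Lemma condexpX_sum (iT : eqType) (s : seq iT) (c : iT -> R) (u : iT -> T -> R)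
    (M : set nat) :
  {in s, forall i, u i \in Lfun P 2%:E} ->
  CE M (fun t => \sum_(i <- s) c i * u i t) =
  (fun t => \sum_(i <- s) c i * CE M (u i) t) %[ae P].
Proof.
elim: s => [|i r IH] u2.
  rewrite (_ : (fun t => \sum_(i <- [::]) c i * u i t) = cst 0); last first.
    by apply/funext => t; rewrite big_nil.
  have : CE M (cst 0) = cst 0 %[ae P].
    apply: condexpX_id; first exact: integrable_cst.
    by rewrite sigmaX_cylinder; exact: preimage_cst.
  by apply: filterS => x /(_ I) -> _; rewrite big_nil.
have ui : u i \in Lfun P 2%:E by apply: u2; rewrite mem_head.
have ur : {in r, forall i, u i \in Lfun P 2%:E}.
  by move=> j jr; apply: u2; rewrite in_cons jr orbT.
rewrite (_ : (fun t => \sum_(j <- i :: r) c j * u j t) =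
    fun t => c i * u i t + \sum_(j <- r) c j * u j t); last first.
  by apply/funext => t; rewrite big_cons.
have r2 := Lfun2_integrable (Lfun2_sum c ur).
have H1 := condexpX_lin X M (c i) (Lfun2_integrable ui) r2; have H2 := IH ur.
apply: filterS2 H1 H2.
by move=> x /(_ I) -> /(_ I) -> _; rewrite big_cons.
Qed.

Lemma component_Lfun2 f M : f \in Lfun P 2%:E -> component f M \in Lfun P 2%:E.
Proof. by move=> f2; apply: Lfun2_sum => L _; exact: condexpX_Lfun2. Qed.

Lemma component_sub_sigma f M : f \in Lfun P 2%:E ->
  g_sigma_algebra_preimage (component f M) `<=` sigmaX X [set` M].
Proof.
move=> f2; rewrite sigmaX_cylinder; apply: preimage_sum => L.
rewrite -sigmaX_cylinder fpowersetE => /fsubsetP LM.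
apply: subset_trans (condexpX_sub_sigma (Lfun2_integrable f2)) _.
by apply: sub_sigmaX => n; exact: LM.
Qed.

Lemma sum_component_fpowerset f K t :
  \sum_(M <- fpowerset K) component f M t = CE [set` K] f t.
Proof. exact: (moebius_inversion K (fun L => CE [set` L] f t)). Qed.

Hypothesis indX : mutually_independent P X.

(** The component becomes the alternating sum of E[f | K & L] over L <= M, and
    K & L is unchanged when an element of M outside K is toggled in L. *)
Lemma condexpX_component_eq0 f M (K : set nat) : f \in Lfun P 2%:E ->
  ~ [set` M] `<=` K -> CE K (component f M) = cst 0 %[ae P].
Proof.
move=> f2 MK; have [j jM jK] : exists2 j, j \in M & ~ K j.
  apply: contrapT => nj; apply: MK => j jM; apply: contrapT => jK.
  by apply: nj; exists j.
have H1 := @condexpX_sum _ (fpowerset M) (fun L => (-1) ^+ (#|` M| - #|` L|))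
  (fun L => CE [set` L] f) K (fun L _ => condexpX_Lfun2 X [set` L] f2).
have H2 := @ae_eq_sum _ (fpowerset M) (fun L => (-1) ^+ (#|` M| - #|` L|)) _ _
   (fun L _ => condexpX_condexpX indX K [set` L] (Lfun2_integrable f2)).
apply: filterS2 H1 H2 => x /(_ I) + /(_ I) + _.
rewrite -/(component f M) => -> ->.
apply: (alternating_sum_eq0 (c := fun L => CE (K `&` [set` L]) f x) jM) => L.
congr (condexp P (sigmaX X _) f x); apply/seteqP; split=> n /= [Kn];
  rewrite in_toggle; by case: eqP Kn => [->//|_ Kn]; split.
Qed.

(** If M is not included in N, then component g N is measurable for N, so the
    integral of the product only sees E[component f M | N] = 0.  The opposite
    case is symmetric. *)
Lemma component_orthogonal f g M N : f \in Lfun P 2%:E -> g \in Lfun P 2%:E -> M != N ->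
  \int[P]_x (component f M x * component g N x) = 0.
Proof.
wlog MN : f g M N / ~ [set` M] `<=` [set` N].
  move=> H f2 g2 MN; have [NM|NM] := pselect ([set` N] `<=` [set` M]); last first.
    under eq_Rintegral do rewrite mulrC.
    by apply: H => //; rewrite eq_sym.
  apply: H => // subMN; move/eqP : MN; apply; apply/fsetP => n.
  by apply/idP/idP; [exact: subMN|exact: NM].
move=> f2 g2 _; have fM := component_Lfun2 M f2; have gN := component_Lfun2 N g2.
under eq_Rintegral do rewrite mulrC.
rewrite -(Rintegral_mul_condexpX fM gN (component_sub_sigma g2)).
rewrite (@eq_Rintegral_ae _ _ _ P _ (cst 0)) ?Rintegral_cst ?mul0r//.
- apply: measurable_funM; first exact: Lfun2_measurable gN.
  exact/Lfun2_measurable/condexpX_Lfun2.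
- by apply: filterS (condexpX_component_eq0 f2 MN) => x /(_ I) -> _; rewrite mulr0.
Qed.

(** Both sides equal the integral of E[f | N] times the component at N: by
    self-adjointness for the left one, and for the right one because E[f | N] is
    the sum of the components at subsets of N, all but one orthogonal to it. *)
Lemma component_mul_self f N : f \in Lfun P 2%:E ->
  \int[P]_x (f x * component f N x) = \int[P]_x (component f N x * component f N x).
Proof.
move=> f2; have fN := component_Lfun2 N f2.
under eq_Rintegral do rewrite mulrC.
rewrite -(Rintegral_mul_condexpX f2 fN (component_sub_sigma f2)).
under eq_Rintegral do rewrite mulrC -sum_component_fpowerset.
under eq_Rintegral do under eq_bigr do rewrite -[component _ _ _]mul1r.
rewrite (Rintegral_sum_mul (fun=> 1))//; last by move=> M _; exact: component_Lfun2.
rewrite (big_fsetD1 N) ?fpowersetE//= mul1r big_seq big1 ?addr0// => M.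
by rewrite !inE => /andP[MN _]; rewrite mul1r component_orthogonal.
Qed.

End hoeffding_components.

(** * Approximation by finitely many coordinates *)

Section hoeffding_sum.
Context d (T : measurableType d) (R : realType).
Variable P : probability T R.
Context (dE : nat -> measure_display) (E : forall n, measurableType (dE n)).
Variable X : forall n, {RV P >-> E n}.
Implicit Types (f g h u v : T -> R) (A : set T) (K L M N : {fset nat}).

Local Notation CE M := (condexp P (sigmaX X M)).

Lemma Rintegral_sqrD u v : u \in Lfun P 2%:E -> v \in Lfun P 2%:E ->
  \int[P]_x ((u x + v x) ^+ 2) =
  \int[P]_x (u x ^+ 2) + (2 * \int[P]_x (u x * v x) + \int[P]_x (v x ^+ 2)).
Proof.
move=> u2 v2; have ui := Lfun2_integrable_sqr u2; have vi := Lfun2_integrable_sqr v2.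
have uvi := Lfun2_mul_integrable u2 v2.
have -> : (fun x => (u x + v x) ^+ 2) =
    fun x => 1 * u x ^+ 2 + (2 * (u x * v x) + v x ^+ 2).
  by apply/funext => x; ring.
by rewrite !Rintegral_lin ?mul1r//; exact: integrable_lin.
Qed.

Lemma Rintegral_sqr_ge0 u : 0 <= \int[P]_x (u x ^+ 2).
Proof. by apply: Rintegral_ge0 => x _; exact: sqr_ge0. Qed.

Lemma pythagoras_le u v : u \in Lfun P 2%:E -> v \in Lfun P 2%:E ->
  \int[P]_x (u x * v x) = 0 ->
  \int[P]_x (u x ^+ 2) <= \int[P]_x ((u x + v x) ^+ 2).
Proof.
by move=> u2 v2 uv; rewrite Rintegral_sqrD// uv mulr0 add0r lerDl Rintegral_sqr_ge0.
Qed.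

Lemma Rintegral_sqr_lin_le a u v : u \in Lfun P 2%:E -> v \in Lfun P 2%:E ->
  \int[P]_x ((a * u x + v x) ^+ 2) <=
  (2 * a ^+ 2) * \int[P]_x (u x ^+ 2) + 2 * \int[P]_x (v x ^+ 2).
Proof.
move=> u2 v2; have ui := Lfun2_integrable_sqr u2; have vi := Lfun2_integrable_sqr v2.
have v2i : P.-integrable setT (EFin \o (fun x => 2 * v x ^+ 2)).
  by have := integrableZl measurableT 2 vi; apply: eq_integrable.
have <- : \int[P]_x (2 * v x ^+ 2) = 2 * \int[P]_x (v x ^+ 2) by rewrite RintegralZl.
rewrite -Rintegral_lin//.
apply: le_Rintegral => //.
- exact/Lfun2_integrable_sqr/Lfun2_lin.
- exact: integrable_lin.
- by move=> x _; have := sqr_ge0 (a * u x - v x); nra.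
Qed.

Lemma Lfun2B u v : u \in Lfun P 2%:E -> v \in Lfun P 2%:E ->
  (fun x => u x - v x) \in Lfun P 2%:E.
Proof.
move=> u2 v2; rewrite (_ : (fun x => _) = fun x => -1 * v x + u x); last first.
  by apply/funext => x; ring.
exact: Lfun2_lin.
Qed.

(** Functions that can be approximated in L^2 by functions of finitely many
    coordinates form a linear space closed under dominated limits and contain the
    indicators of cylinders, hence contain every f in [L2X].  The conditional
    expectation is then the best approximation by functions of the coordinates in
    K. *)
Lemma finite_approx f : L2X P X f -> forall e, 0 < e ->
  exists K, \int[P]_x ((f x - CE [set` K] f x) ^+ 2) < e.
Proof.
move=> [f2 fX].
pose V := [set g : T -> R | g \in Lfun P 2%:E /\ forall e, 0 < e -> exists K h,
  [/\ h \in Lfun P 2%:E, g_sigma_algebra_preimage h `<=` sigmaX X [set` K] &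
      \int[P]_x ((g x - h x) ^+ 2) < e]].
pose b x := 1 * cst 1 x + `|f x|.
have b2 : b \in Lfun P 2%:E by apply: Lfun2_lin; [exact: Lfun_cst|exact: Lfun2_norm].
have [_ Vf] : V f.
  apply: (@functional_monotone_class _ _ (cylinder X setT) V b).
  - exact: cylinder_setI.
  - exact: cylinder_setT.
  - by move=> x; rewrite /b mul1r lerDl.
  - move=> A TA; have A2 := Lfun2_indic P (cylinder_measurable TA).
    split=> // e e0; case: TA => J [S [_ XS AE]].
    exists J, \1_A; split => //.
      rewrite sigmaX_cylinder; apply: preimage_indic; apply: sub_sigma_algebra.
      by exists J, S; split.
    rewrite (_ : (fun x => _) = cst 0) ?Rintegral_cst ?mul0r//.
    by apply/funext => x; rewrite subrr expr0n.
  (* linearity: e' is such that 2 a^2 e' + 2 e' = e *)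
  - move=> a g k [g2 Vg] [k2 Vk]; split; first exact: Lfun2_lin.
    move=> e e0; pose e' := e / (2 * a ^+ 2 + 2).
    have a0 : 0 < 2 * a ^+ 2 + 2 by have := sqr_ge0 a; lra.
    have e'0 : 0 < e' by exact: divr_gt0.
    have [K1 [h1 [h12 h1K gh1]]] := Vg _ e'0.
    have [K2 [h2 [h22 h2K gh2]]] := Vk _ e'0.
    exists (K1 `|` K2)%fset, (fun x => a * h1 x + h2 x); split.
    + exact: Lfun2_lin.
    + rewrite sigmaX_cylinder; apply: preimage_lin; rewrite -sigmaX_cylinder.
        apply: subset_trans h1K _; apply: sub_sigmaX => n /= nK.
        by rewrite in_fsetU nK.
      apply: subset_trans h2K _; apply: sub_sigmaX => n /= nK.
      by rewrite in_fsetU nK orbT.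
    + rewrite (_ : (fun x => _) =
        fun x => (a * (g x - h1 x) + (k x - h2 x)) ^+ 2); last first.
        by apply/funext => x; ring.
      apply: (le_lt_trans (Rintegral_sqr_lin_le _ _ _)); [exact: Lfun2B..|].
      have -> : e = 2 * a ^+ 2 * e' + 2 * e'.
        by rewrite -mulrDl mulrC divfK// gt_eqF.
      apply: ler_ltD; last by rewrite ltr_pM2l.
      by rewrite ler_wpM2l ?(ltW gh1)// mulr_ge0// sqr_ge0.
  (* dominated limits: |g - g_ n| <= 2 b, so 4 b^2 dominates the squares *)
  - move=> g_ g Vg gb gg.
    have mg n : measurable_fun setT (g_ n) by case: (Vg n) => /Lfun2_measurable.
    have mg' : measurable_fun setT g by apply: (measurable_fun_cvg mg) => x _; exact: gg.
    have gb' x : `|g x| <= `|b x|.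
      apply: (cvgr_to_le (cvg_norm (gg x))); apply: nearW => n.
      by apply: (le_trans (gb n x)); exact: ler_norm.
    have g2 : g \in Lfun P 2%:E by exact: Lfun2_le b2 gb'.
    split=> // e e0.
    have [||||_ _] := @dominated_Rintegral _ _ _ P
      (fun n x => (g x - g_ n x) ^+ 2) (cst 0) (fun x => 4 * b x ^+ 2 + cst 0 x).
    + by move=> n; apply: measurable_funX; exact: measurable_funB.
    + apply: integrable_lin; first exact: Lfun2_integrable_sqr.
      exact: integrable_cst.
    + move=> n x; rewrite addr0 ger0_norm ?sqr_ge0//.
      have b0 : 0 <= b x by rewrite /b addr_ge0// mul1r.
      have := gb n x; have := gb' x; rewrite (ger0_norm b0) !ler_norml.
      by move=> /andP[? ?] /andP[? ?]; nra.
    + move=> x; have -> : cst 0 x = (g x - g x) ^+ 2 :> R by rewrite subrr expr0n.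
      apply: (@cvg_comp _ _ _ _ (fun y => y ^+ 2)); last exact: exprn_continuous.
      by apply: cvgB; [exact: cvg_cst|exact: gg].
    rewrite Rintegral_cst// mul0r => /cvgrPdist_lt/(_ (e / 4)).
    have e4 : 0 < e / 4 by lra.
    move=> /(_ e4)[n _ /(_ n (leqnn n))]; rewrite /= sub0r normrN.
    rewrite ger0_norm ?Rintegral_sqr_ge0// => gn.
    have [_ Vn] := Vg n; have [K [h [h2 hK gh]]] := Vn _ e4.
    exists K, h; split => //.
    rewrite (_ : (fun x => _) =
      fun x => (1 * (g x - g_ n x) + (g_ n x - h x)) ^+ 2); last first.
      by apply/funext => x; ring.
    have gn2 : g_ n \in Lfun P 2%:E by case: (Vg n).
    apply: (le_lt_trans (Rintegral_sqr_lin_le _ _ _)); [exact: Lfun2B..|].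
    by move: gn gh; lra.
  - by rewrite -sigmaX_cylinder.
  - by move=> x; rewrite /b mul1r lerDr.
move=> e e0; have [K [h [h2 hK fh]]] := Vf e e0; exists K.
apply: le_lt_trans fh.
have e2 := condexpX_Lfun2 X [set` K] f2.
pose u x := f x - CE [set` K] f x; pose v x := CE [set` K] f x - h x.
have v2 : v \in Lfun P 2%:E by exact: Lfun2B.
have u2 : u \in Lfun P 2%:E by exact: Lfun2B.
rewrite [leRHS](_ : _ = \int[P]_x ((u x + v x) ^+ 2)); last first.
  by apply: eq_Rintegral => x _; congr (_ ^+ 2); rewrite /u /v; ring.
apply: pythagoras_le => //.
have vK : g_sigma_algebra_preimage v `<=` sigmaX X [set` K].
  rewrite (_ : v = fun x => -1 * h x + CE [set` K] f x); last first.
    by apply/funext => x; rewrite /v; ring.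
  have := condexpX_sub_sigma (X := X) (M := [set` K]) (Lfun2_integrable f2).
  by move: hK; rewrite sigmaX_cylinder; exact: preimage_lin.
rewrite (_ : (fun x => _) = fun x => -1 * (v x * CE [set` K] f x) + v x * f x); last first.
  by apply/funext => x; rewrite /u; ring.
rewrite Rintegral_lin ?(Rintegral_mul_condexpX f2 v2 vK) ?mulN1r ?addNr//;
  exact: Lfun2_mul_integrable.
Qed.

End hoeffding_sum.

(** * Unconditional convergence and the operator D *)

Section hoeffding_convergence.
Context d (T : measurableType d) (R : realType).
Variable P : probability T R.
Context (dE : nat -> measure_display) (E : forall n, measurableType (dE n)).
Variable X : forall n, {RV P >-> E n}.
Implicit Types (f g h u v : T -> R) (A : set T) (K L M N : {fset nat}).

Local Notation CE M := (condexp P (sigmaX X M)).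
Local Notation component := (hoeffding_component P X).

Lemma sum_mul1 (iT : Type) (s : seq iT) (u : iT -> T -> R) x :
  \sum_(i <- s) u i x = \sum_(i <- s) 1 * u i x.
Proof. by apply: eq_bigr => i _; rewrite mul1r. Qed.

Lemma Lfun2_sum1 (iT : eqType) (s : seq iT) (u : iT -> T -> R) :
  {in s, forall i, u i \in Lfun P 2%:E} ->
  (fun x => \sum_(i <- s) u i x) \in Lfun P 2%:E.
Proof. by move=> u2; under eq_fun do rewrite sum_mul1; exact: Lfun2_sum. Qed.

(** The L^2 norm as a real number, to reduce convergence in L^2 to estimates on
    real integrals of squares. *)
Lemma Lnorm2E u : u \in Lfun P 2%:E ->
  ('N[P]_2%:E[EFin \o u] = (Num.sqrt (\int[P]_x (u x ^+ 2)))%:E)%E.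
Proof.
move=> u2; have ui := Lfun2_integrable_sqr u2.
rewrite unlock /Lnorm -powR12_sqrt ?Rintegral_sqr_ge0// -poweR_EFin.
rewrite /Rintegral fineK ?(integrable_fin_num measurableT ui)//.
congr (_ `^ _)%E; apply: eq_integral => x _ /=.
by rewrite powR_mulrn// -normrX ger0_norm ?sqr_ge0.
Qed.

Hypothesis indX : mutually_independent P X.

(** Any partial sum over a finite J containing all subsets of K approximates f at
    least as well as E[f | K] does: the difference f - E[f | K] is the sum of the
    remainder f - \sum_(M in J) component f M and of components with index in J,
    all of them orthogonal to the remainder. *)
Lemma partial_sum_le f K (J : {fset {fset nat}}) : f \in Lfun P 2%:E ->
  (fpowerset K `<=` J)%fset ->
  \int[P]_x ((f x - \sum_(M <- J) component f M x) ^+ 2) <=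
  \int[P]_x ((f x - CE [set` K] f x) ^+ 2).
Proof.
move=> f2 KJ; have c2 M : component f M \in Lfun P 2%:E by exact: component_Lfun2.
have S2 (s : seq {fset nat}) : (fun x => \sum_(M <- s) component f M x) \in Lfun P 2%:E.
  exact: Lfun2_sum1.
pose u x := f x - \sum_(M <- J) component f M x.
pose JK := [fset M in J | M \notin fpowerset K]%fset.
pose v x := \sum_(M <- JK) component f M x.
have u2 : u \in Lfun P 2%:E by exact: Lfun2B.
have uv x : u x + v x = f x - CE [set` K] f x.
  rewrite /u /v -sum_component_fpowerset [in LHS](big_fsetID _ (mem (fpowerset K)))/=.
  rewrite (_ : [fset _ | _ in _ & _ \in fpowerset K]%fset = fpowerset K).
    by rewrite -/JK opprD addrA addrNK.
  apply/fsetP => M; rewrite !inE/=.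
  by case: (boolP (M \in fpowerset K)) => [/(fsubsetP KJ) ->|]; rewrite ?andbF.
rewrite -[leRHS](_ : \int[P]_x ((u x + v x) ^+ 2) = _); last first.
  by apply: eq_Rintegral => x _; rewrite uv.
apply: pythagoras_le => //; first exact: S2.
under eq_Rintegral do rewrite mulrC.
have -> : (fun x => v x * u x) = fun x => (\sum_(M <- JK) 1 * component f M x) * u x.
  by apply/funext => x; rewrite -sum_mul1.
rewrite Rintegral_sum_mul// big_seq big1// => N; rewrite !inE => /andP[NJ _].
have -> : (fun x => component f N x * u x) = fun x =>
    -1 * ((\sum_(M <- J) 1 * component f M x) * component f N x) + f x * component f N x.
  by apply/funext => x; rewrite /u -sum_mul1; ring.
rewrite Rintegral_lin ?Rintegral_sum_mul//; last 2 first.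
- by apply: Lfun2_mul_integrable => //; exact: Lfun2_sum.
- exact: Lfun2_mul_integrable.
rewrite (big_fsetD1 N)//= big_seq big1 => [|M].
  by rewrite addr0 component_mul_self//; ring.
by rewrite !inE => /andP[MN _]; rewrite component_orthogonal// mulr0.
Qed.

Lemma unconditional_sum_component f : L2X P X f ->
  L2_unconditional_sum P predT (component f) f.
Proof.
move=> fX; have [f2 _] := fX.
have c2 M : component f M \in Lfun P 2%:E by exact: component_Lfun2.
have FF := @summability.totally_filter {fset nat}.
rewrite /L2_unconditional_sum.
have NE (J : {fset {fset nat}}) :
    ('N[P]_2%:E[(fun t => (f t - \sum_(M <- J | M \in predT) component f M t)%:E)] =
    (Num.sqrt (\int[P]_x ((f x - \sum_(M <- J) component f M x) ^+ 2)))%:E)%E.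
  rewrite -Lnorm2E//; apply: Lfun2B => //.
  exact: Lfun2_sum1.
under eq_fun do rewrite NE.
apply: cvg_EFin; first exact: nearW.
apply/cvgrPdist_lt => e e0.
have [K fK] := finite_approx fX (exprn_gt0 2 e0).
exists (fpowerset K) => // J /= KJ.
rewrite sub0r normrN ger0_norm ?sqrtr_ge0//.
rewrite -(ger0_norm (ltW e0)) -sqrtr_sqr ltr_sqrt ?exprn_gt0//.
exact: le_lt_trans (partial_sum_le f2 KJ) fK.
Qed.

Lemma expectation_mul u v : u \in Lfun P 2%:E -> v \in Lfun P 2%:E ->
  ('E_P[(fun t => u t * v t)%R] = (\int[P]_x (u x * v x))%:E)%E.
Proof.
move=> u2 v2; rewrite unlock /Rintegral fineK//.
exact: (integrable_fin_num measurableT (Lfun2_mul_integrable u2 v2)).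
Qed.

Variable k : nat.

Lemma D_Lfun2 f : f \in Lfun P 2%:E -> D P X k f \in Lfun P 2%:E.
Proof. by move=> f2; apply: Lfun2B => //; exact: condexpX_Lfun2. Qed.

Lemma D_linE f : D P X k f = fun x => -1 * CE [set j | j <> k] f x + f x.
Proof. by apply/funext => x; rewrite /D; ring. Qed.

Lemma L2X_D f : L2X P X f -> L2X P X (D P X k f).
Proof.
move=> [f2 fX]; split; first exact: D_Lfun2.
have := subset_trans (condexpX_sub_sigma (X := X) (M := [set j | j <> k])
  (Lfun2_integrable f2)) (sub_sigmaX (@subsetT _ _)).
by move: fX; rewrite D_linE sigmaX_cylinder => ? ?; exact: preimage_lin.
Qed.

(** E[D f | L] is E[f | L] - E[f | L minus k].  If k is in M, the alternating sum
    of the second terms vanishes, because L minus k is unchanged when k is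
    toggled in L; if k is not in M, then L minus k is L for every L <= M, and
    every term vanishes. *)
Lemma component_D f M : f \in Lfun P 2%:E ->
  component (D P X k f) M = (if k \in M then component f M else cst 0) %[ae P].
Proof.
move=> f2; have fi := Lfun2_integrable f2.
have ei := condexpX_integrable X [set j | j <> k] fi.
have CED L : CE [set` L] (D P X k f) =
    (fun x => -1 * CE ([set` L] `&` [set j | j <> k]) f x + CE [set` L] f x) %[ae P].
  have H1 := condexpX_lin X [set` L] (-1) ei fi.
  have H2 := condexpX_condexpX indX [set` L] [set j | j <> k] fi.
  by rewrite D_linE; apply: filterS2 H1 H2 => x /(_ I) -> /(_ I) ->.
have H := @ae_eq_sum _ _ _ P _ (fpowerset M)
  (fun L => (-1) ^+ (#|` M| - #|` L|)) _ _ (fun L _ => CED L).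
apply: filterS H => x /(_ I) Hx _; apply: (etrans Hx).
case: ifPn => kM.
  rewrite (eq_bigr (fun L => -1 * ((-1) ^+ (#|` M| - #|` L|) *
        CE ([set` L] `&` [set j | j <> k]) f x) +
      (-1) ^+ (#|` M| - #|` L|) * CE [set` L] f x)) => [|L _]; last by ring.
  rewrite big_split/= -mulr_sumr (alternating_sum_eq0 (c := fun L =>
    CE ([set` L] `&` [set j | j <> k]) f x) kM) ?mulr0 ?add0r// => L.
  congr (condexp P (sigmaX X _) f x).
  by apply/seteqP; split=> n /= [+ nk]; rewrite in_toggle; case: eqP nk => // _ _; split.
rewrite big_seq big1// => L; rewrite fpowersetE => /fsubsetP LM.
rewrite (_ : [set` L] `&` _ = [set` L]) ?mulN1r ?addNr ?mulr0//.
apply/setIidPl => n /= nL nk; move/negP : kM; apply; apply: LM.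
by rewrite -nk.
Qed.

(** The Hoeffding decomposition of an arbitrary function of L2X, with the freedom
    to modify the components on null sets: this freedom is needed for D f,
    whose components are only almost everywhere those of f or 0. *)
Lemma hoeffding_decomposition_of_components f (g : {fset nat} -> T -> R) : L2X P X f ->
  (forall M, g M = component f M %[ae P]) ->
  (forall M, g M \in Lfun P 2%:E) ->
  (forall M, g_sigma_algebra_preimage (g M) `<=` sigmaX X [set` M]) ->
  hoeffding_decomposition P X f g.
Proof.
move=> fX gE g2 gM; have [f2 _] := fX.
have FF := @summability.totally_filter {fset nat}.
have c2 M : component f M \in Lfun P 2%:E by exact: component_Lfun2.
split => //.
- move=> M K MK; rewrite (@condexpX_ae _ _ _ P _ _ X K (g M) (component f M))//.
  + exact: condexpX_component_eq0.
  + exact: Lfun2_measurable.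
  + exact: Lfun2_measurable.
- move=> M N MN; rewrite expectation_mul//; congr EFin.
  rewrite -(component_orthogonal indX f2 f2 MN); apply: eq_Rintegral_ae.
  + by apply: measurable_funM; exact: Lfun2_measurable.
  + by apply: measurable_funM; exact: Lfun2_measurable.
  + have H1 := gE M; have H2 := gE N.
    by apply: filterS2 H1 H2 => x /(_ I) -> /(_ I) ->.
- apply: cvg_trans (unconditional_sum_component fX).
  apply: near_eq_cvg; apply: nearW => J.
  have s2 (u : {fset nat} -> T -> R) : (forall M, u M \in Lfun P 2%:E) ->
      (fun t => f t - \sum_(M <- J) u M t) \in Lfun P 2%:E.
    by move=> u2; apply: Lfun2B => //; exact: Lfun2_sum1.
  rewrite !Lnorm2E; [|exact: s2..]; congr ((Num.sqrt _)%:E).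
  apply: eq_Rintegral_ae.
  + by apply/measurable_funX/Lfun2_measurable/s2.
  + by apply/measurable_funX/Lfun2_measurable/s2.
  + have H := @ae_eq_sum _ _ _ P _ J (fun=> 1) _ _ (fun M _ => gE M).
    by apply: filterS H => x /(_ I) + _; rewrite -!sum_mul1 => ->.
Qed.

Lemma hoeffding_decomposition_D f : L2X P X f ->
  hoeffding_decomposition P X (D P X k f)
    (fun M => if k \in M then component f M else cst 0).
Proof.
move=> fX; have [f2 _] := fX; apply: hoeffding_decomposition_of_components => [|M|M|M].
- exact: L2X_D.
- by apply: filterS (component_D M f2) => x /(_ I) ->.
- by case: ifP => _; [exact: component_Lfun2|exact: Lfun_cst].
- case: ifP => _; first exact: component_sub_sigma.
  by rewrite sigmaX_cylinder; exact: preimage_cst.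
Qed.

End hoeffding_convergence.

Theorem proposition2p3 (R : realType) (d : measure_display)
    (T : measurableType d) (P : probability T R)
    (dE : nat -> measure_display) (E : forall n, measurableType (dE n))
    (X : forall n, {RV P >-> E n}) (indX : mutually_independent P X)
    (F : T -> R) (FL2 : L2X P X F) (k : nat) :
  [/\ L2X P X (D P X k F),
      hoeffding_decomposition P X (D P X k F)
        (fun M => if k \in M then hoeffding_component P X F M else cst 0)
    & L2_unconditional_sum P [pred M : {fset nat} | k \in M]
        (hoeffding_component P X F) (D P X k F)].
Proof.
have DF := hoeffding_decomposition_D indX k FL2.
split=> //; first exact: L2X_D.
apply: cvg_trans (hoeffding_sum DF).
have FF := @summability.totally_filter {fset nat}.
apply: near_eq_cvg; apply: nearW => J; apply: eq_Lnorm => t.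
congr (_ - _)%:E; rewrite big_mkcond [RHS]big_mkcond.
by apply: eq_bigr => M _; rewrite !inE; case: ifP.
Qed.
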